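(* Let $d,n$ be positive integers and suppose $d\geq \xi n^2$ for some $\xi=\xi(n)\geq 2n^{-1}$. Then $$p_d(n)<3a^{2n}e^{\frac{125n}{\xi}}n^2e^n\frac{d^n}{n^n}\qquad\text{with } a=\max\{2e^{3.5}\xi^{-1},1\}.$$ In particular, if $\xi(n)\to\infty$ as $n\to\infty$, then $p_d(n)=e^n\frac{d^n}{n^n}e^{o(n)}$.
   Context: $\mathbb{Z}_+=\{0,1,2,\dots\}$. A set $S\subset\mathbb{Z}_+^d$ is a lower set if whenever $\mathbf{x}\in S$ and $\mathbf{x}'\in\mathbb{Z}_+^d$ satisfies $x'_i\leq x_i$ for all $i$, then $\mathbf{x}'\in S$. $p_d(n)$ denotes the number of lower sets in $\mathbb{Z}_+^d$ with exactly $n$ points. *)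

(* Defs.v *)
From mathcomp Require Import all_boot.
From mathcomp Require Import finmap.
From Stdlib Require Import Reals.

Set Implicit Arguments.
Unset Strict Implicit.
Unset Printing Implicit Defensive.

Local Open Scope fset_scope.

Definition point (d : nat) := (d.-tuple nat).

Definition lower_set (d : nat) (S : {fset point d}) : Prop :=
  forall x : point d, x \in S ->
  forall y : point d, (forall i : 'I_d, tnth y i <= tnth x i) -> y \in S.

(* is_pd d n k : k is the number of lower sets in Z_+^d with exactly n points,
   witnessed by a duplicate-free enumeration of exactly those sets.
   (Any lower set with n points is finite, so it is an fset.)  *)
Definition is_pd (d n k : nat) : Prop :=
  exists s : seq {fset point d},
    [/\ uniq s, size s = k &
        forall S : {fset point d}, S \in s <-> (lower_set S /\ #|` S| = n)].

(* Main.v *)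
Require Import Defs.
From mathcomp Require Import all_boot.
From mathcomp Require Import finmap.
From Stdlib Require Import Reals.
From Stdlib Require Import ClassicalEpsilon Lra.
From mathcomp Require Import zify.
(* Reals rebinds [_ ^ _] in nat_scope; this restores [expn]. *)
From mathcomp Require Import ssrnat.

Set Implicit Arguments.
Unset Strict Implicit.
Unset Printing Implicit Defensive.

(* Order Z_+^d totally, refining the coordinate sum, and let the parent of
   x <> 0 be x with its first nonzero coordinate decreased by one.  A lower set
   S with n points contains the parents of its points, so it can be rebuilt
   weight level by weight level from its n - 1 labels (rank in S of the parent
   of x, direction i of x - parent x), x in S \ {0}.  If (r, i) is a label then
   the unit vector e_i lies in S and (0, i) is a label, so the labels form a set
   J of directions together with n - 1 - |J| cells of [n] x J.  Hence
   (n-1)! p_d(n) <= (n-1)! sum_j C(d, j) C(nj, n-1-j) <= (n^2 + d)^(n-1)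
   <= d^(n-1) e^(n/xi), and n^n <= n! e^n yields a bound stronger than the
   claimed one. *)

Section Points.
Variable d' : nat.
Local Notation d := d'.+1.
Local Notation pt := (point d).

Definition weight (x : pt) := \sum_(i < d) tnth x i.

Definition pt0 : pt := [tuple 0 | _ < d].

Definition axis_pt (i : 'I_d) (c : nat) : pt := [tuple if j == i then c else 0 | j < d].

Lemma weight_eq0 x : (weight x == 0) = (x == pt0).
Proof.
apply/idP/eqP => [|->]; last by rewrite /weight big1 // => i _; rewrite tnth_mktuple.
rewrite /weight sum_nat_eq0 => /forallP x0.
by apply: eq_from_tnth => i; rewrite tnth_mktuple; apply/eqP/x0.
Qed.

Definition ltpt (x y : pt) :=
  (weight x < weight y) || (weight x == weight y) && (choice.pickle x < choice.pickle y).

Lemma ltptnn x : ltpt x x = false.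
Proof. by rewrite /ltpt ltnn eqxx ltnn. Qed.

Lemma ltpt_trans y x z : ltpt x y -> ltpt y z -> ltpt x z.
Proof.
rewrite /ltpt => /orP[lt_xy|/andP[/eqP e_xy lt_xy]] /orP[lt_yz|/andP[/eqP e_yz lt_yz]].
- by rewrite (ltn_trans lt_xy lt_yz).
- by rewrite -e_yz lt_xy.
- by rewrite e_xy lt_yz.
- by rewrite e_xy e_yz eqxx (ltn_trans lt_xy lt_yz) orbT.
Qed.

Lemma ltpt_total x y : x != y -> ltpt x y || ltpt y x.
Proof.
move=> neq_xy; rewrite /ltpt eq_sym.
case: ltngtP => //= _; case: ltngtP => // /(pcan_inj (@choice.pickleK _)) eq_xy.
by rewrite eq_xy eqxx in neq_xy.
Qed.

Lemma ltpt_weight x y : ltpt x y -> weight x <= weight y.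
Proof. by case/orP=> [/ltnW|/andP[/eqP-> _]]. Qed.

Lemma ltpt0 x : ltpt x pt0 = false.
Proof.
apply/negP => lt_x0; have /eqP w0 : weight pt0 == 0 by rewrite weight_eq0.
have := ltpt_weight lt_x0; rewrite w0 leqn0 weight_eq0 => /eqP eq_x0.
by rewrite eq_x0 ltptnn in lt_x0.
Qed.

Definition first_nz (x : pt) : 'I_d := odflt ord0 [pick i | tnth x i != 0].

Lemma first_nzP x : x != pt0 -> tnth x (first_nz x) != 0.
Proof.
rewrite /first_nz; case: pickP => [i -> //|x0] /= /eqP[].
by apply: eq_from_tnth => i; rewrite tnth_mktuple; apply/eqP/negbFE/x0.
Qed.

Definition parent (x : pt) : pt := [tuple tnth x j - (j == first_nz x) | j < d].

Lemma parent_le x i : tnth (parent x) i <= tnth x i.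
Proof. by rewrite tnth_mktuple leq_subr. Qed.

Lemma tnth_parent x j : x != pt0 -> tnth x j = tnth (parent x) j + (j == first_nz x).
Proof.
move=> nz_x; rewrite tnth_mktuple; case: eqP => [->|_]; last by rewrite !subn0 addn0.
by rewrite subnK // lt0n first_nzP.
Qed.

Lemma weight_parent x : x != pt0 -> weight x = (weight (parent x)).+1.
Proof.
move=> nz_x; rewrite /weight (bigD1 (first_nz x)) //= [in RHS](bigD1 (first_nz x)) //=.
rewrite (tnth_parent _ nz_x) eqxx addn1 addSn; congr (_ + _).+1.
by apply: eq_bigr => j /negPf nfj; rewrite (tnth_parent _ nz_x) nfj addn0.
Qed.

Lemma parent_inj x y : x != pt0 -> y != pt0 ->
  parent x = parent y -> first_nz x = first_nz y -> x = y.
Proof.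
move=> nz_x nz_y eq_p eq_f; apply: eq_from_tnth => j.
by rewrite (tnth_parent _ nz_x) (tnth_parent _ nz_y) eq_p eq_f.
Qed.

Lemma axis_pt_nz i : axis_pt i 1 != pt0.
Proof. by apply/eqP => /(congr1 (fun t => tnth t i)); rewrite !tnth_mktuple eqxx. Qed.

Lemma first_nz_axis_pt i : first_nz (axis_pt i 1) = i.
Proof.
by have := first_nzP (axis_pt_nz i); rewrite tnth_mktuple; case: (_ =P i).
Qed.

Lemma parent_axis_pt i : parent (axis_pt i 1) = pt0.
Proof.
by apply: eq_from_tnth => j; rewrite !tnth_mktuple first_nz_axis_pt; case: (j == i).
Qed.

End Points.

Section Labels.
Variables d' n' : nat.
Local Notation d := d'.+1.
Local Notation n := n'.+1.
Local Notation pt := (point d).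
Local Open Scope fset_scope.

Lemma lower_set_pt0 (S : {fset pt}) : lower_set S -> S != fset0 -> pt0 d' \in S.
Proof.
by move=> lS /fset0Pn[x xS]; apply: (lS x xS) => i; rewrite tnth_mktuple.
Qed.

Lemma lower_set_parent (S : {fset pt}) x : lower_set S -> x \in S -> parent x \in S.
Proof. by move=> lS xS; apply: (lS x xS) => i; apply: parent_le. Qed.

Lemma lower_set_axis_pt (S : {fset pt}) x i c :
  lower_set S -> x \in S -> c <= tnth x i -> axis_pt i c \in S.
Proof.
by move=> lS xS le_c; apply: (lS x xS) => j; rewrite tnth_mktuple; case: eqP => [->|].
Qed.

Definition rank (S : {fset pt}) (y : pt) := #|` [fset w in S | ltpt w y]|.

Lemma rank_lt (S : {fset pt}) y : y \in S -> rank S y < #|` S|.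
Proof.
move=> yS; rewrite (cardfsD1 y S) yS add1n ltnS; apply: fsubset_leq_card.
apply/fsubsetP => w; rewrite !inE => /andP[wS lt_wy]; rewrite wS andbT.
by apply: contraTneq lt_wy => ->; rewrite ltptnn.
Qed.

Lemma rank_pt0 (S : {fset pt}) : rank S (pt0 d') = 0.
Proof.
by apply/eqP; rewrite cardfs_eq0; apply/eqP/fsetP => w; rewrite !inE ltpt0 andbF.
Qed.

Lemma ltpt_rank (S : {fset pt}) y z : y \in S -> ltpt y z -> rank S y < rank S z.
Proof.
move=> yS lt_yz; apply: fproper_ltn_card; rewrite fproperE; apply/andP; split.
  by apply/fsubsetP => w; rewrite !inE => /andP[-> /ltpt_trans ->].
apply/fsubsetPn; exists y; first by rewrite !inE yS lt_yz.
by rewrite !inE ltptnn andbF.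
Qed.

Lemma rank_inj (S : {fset pt}) : {in S &, injective (rank S)}.
Proof.
move=> y z yS zS eq_r; apply: contraTeq isT => /ltpt_total/orP[] lt.
  by have := ltpt_rank yS lt; rewrite eq_r ltnn.
by have := ltpt_rank zS lt; rewrite eq_r ltnn.
Qed.

Definition label (S : {fset pt}) (x : pt) : 'I_n * 'I_d :=
  (inord (rank S (parent x)), first_nz x).

Definition labels_def (S : {fset pt}) : {set 'I_n * 'I_d} :=
  [set:: [seq label S x | x <- enum_fset S & x != pt0 d']].
Fact labels_key : unit. Proof. by []. Qed.
Definition labels := locked_with labels_key labels_def.
Canonical labels_unlockable := [unlockable fun labels].

Lemma labelsP (S : {fset pt}) p :
  reflect (exists2 x, (x \in S) && (x != pt0 d') & p = label S x) (p \in labels S).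
Proof.
rewrite [labels]unlock inE; apply: (iffP mapP) => [[x]|[x]].
  by rewrite mem_filter andbC => xS ->; exists x.
by move=> xS ->; exists x; rewrite // mem_filter andbC.
Qed.

Section LowerSet.
Variable S : {fset pt}.
Hypotheses (lS : lower_set S) (cS : #|` S| = n).

Lemma rank_parent_lt x : x \in S -> rank S (parent x) < n.
Proof. by move=> xS; rewrite -cS rank_lt // lower_set_parent. Qed.

Lemma label_inj : {in [pred x | (x \in S) && (x != pt0 d')] &, injective (label S)}.
Proof.
move=> x y /andP[xS nz_x] /andP[yS nz_y] [eq_r eq_f].
move: eq_r => /(congr1 val); rewrite /= !inordK ?rank_parent_lt //.
by move/rank_inj; rewrite !lower_set_parent // => /(_ isT isT)/parent_inj; apply.
Qed.

Lemma card_labels : #|labels S| = n'.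
Proof.
have uniq_labels : uniq [seq label S x | x <- enum_fset S & x != pt0 d'].
  rewrite map_inj_in_uniq ?filter_uniq ?fset_uniq // => x y.
  by rewrite !mem_filter ![(_ != _) && _]andbC; apply: label_inj.
rewrite [labels]unlock cardsE (card_uniqP uniq_labels) size_map size_filter.
have := count_predC (pred1 (pt0 d')) (enum_fset S).
have pt0S : pt0 d' \in enum_fset S by apply: (lower_set_pt0 lS); rewrite -cardfs_gt0 cS.
by rewrite count_uniq_mem ?fset_uniq // pt0S cS add1n => -[<-].
Qed.

Lemma labels_axis p : p \in labels S -> (ord0, p.2) \in labels S.
Proof.
case/labelsP=> x /andP[xS nz_x] -> /=; apply/labelsP; exists (axis_pt (first_nz x) 1).
  rewrite axis_pt_nz andbT; apply: lower_set_axis_pt lS xS _.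
  by rewrite lt0n first_nzP.
by rewrite /label parent_axis_pt rank_pt0 first_nz_axis_pt; congr (_, _); apply: val_inj; rewrite /= inordK.
Qed.

End LowerSet.

Lemma labels_mem (S S' : {fset pt}) z :
  lower_set S -> lower_set S' -> #|` S| = n -> #|` S'| = n ->
  labels S = labels S' -> z \in S ->
  (forall w, weight w < weight z -> (w \in S) = (w \in S')) -> z \in S'.
Proof.
move=> lS lS' cS cS' eq_lab zS below.
have [->|nz_z] := eqVneq z (pt0 d').
  by apply: (lower_set_pt0 lS'); rewrite -cardfs_gt0 cS'.
have below_parent w : ltpt w (parent z) -> (w \in S) = (w \in S').
  by move=> /ltpt_weight lt_w; apply: below; rewrite (weight_parent nz_z) ltnS.
have pS' : parent z \in S'.
  by rewrite -below ?(lower_set_parent lS) // (weight_parent nz_z).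
have eq_rank : rank S (parent z) = rank S' (parent z).
  rewrite /rank; congr #|` _|; apply/fsetP => w; rewrite !inE.
  by case lt_w: (ltpt w _); rewrite ?andbT ?andbF ?below_parent.
have : label S z \in labels S' by rewrite -eq_lab; apply/labelsP; exists z; rewrite ?zS.
case/labelsP=> x /andP[xS' nz_x] [/(congr1 val) /= eq_r eq_f].
move: eq_r; rewrite !inordK ?(rank_parent_lt lS) ?(rank_parent_lt lS') // eq_rank.
move/(rank_inj pS' (lower_set_parent lS' xS')) => eq_p.
by rewrite (parent_inj nz_z nz_x eq_p eq_f).
Qed.

Lemma labels_inj (S S' : {fset pt}) :
  lower_set S -> lower_set S' -> #|` S| = n -> #|` S'| = n ->
  labels S = labels S' -> S = S'.
Proof.
move=> lS lS' cS cS' eq_lab; apply/fsetP => z.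
elim: (weight z).+1 {-2}z (ltnSn (weight z)) => // m IH {}z lt_zm.
have below w : weight w < weight z -> (w \in S) = (w \in S').
  by move=> lt_w; apply: IH; apply: leq_trans lt_w _.
apply/idP/idP => zS; first exact: labels_mem lS lS' cS cS' eq_lab zS below.
by apply: labels_mem lS' lS cS' cS (esym eq_lab) zS _ => w /below ->.
Qed.

End Labels.

Section Codes.
Variables d' n' : nat.
Local Notation d := d'.+1.
Local Notation n := n'.+1.
Local Notation pt := (point d).

Definition code (S : {fset pt}) : {set 'I_d} * {set 'I_n * 'I_d} :=
  ([set i | (ord0, i) \in labels n' S], [set p in labels n' S | p.1 != ord0]).

Definition codes : {set {set 'I_d} * {set 'I_n * 'I_d}} :=
  [set c : {set 'I_d} * {set 'I_n * 'I_d} | (c.2 \subset setX setT c.1) && (#|c.1| + #|c.2| == n')].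

Local Open Scope fset_scope.

Lemma labels_code (S : {fset pt}) :
  labels n' S = [set p | if p.1 == ord0 then p.2 \in (code S).1 else p \in (code S).2].
Proof. by apply/setP => -[a b]; rewrite !inE /=; case: eqP => [->|_]; rewrite ?andbT. Qed.

Lemma code_inj (S S' : {fset pt}) :
  lower_set S -> lower_set S' -> #|` S| = n -> #|` S'| = n -> code S = code S' -> S = S'.
Proof.
move=> lS lS' cS cS' eq_code; apply: labels_inj lS lS' cS cS' _.
by rewrite !labels_code eq_code.
Qed.

Lemma code_in_codes (S : {fset pt}) : lower_set S -> #|` S| = n -> code S \in codes.
Proof.
move=> lS cS; rewrite inE /=; apply/andP; split.
  apply/subsetP => -[a b]; rewrite !inE /= => /andP[lab _].
  by have := labels_axis lS lab.
rewrite -[X in _ == X](card_labels lS cS) -(cardID [pred p : 'I_n * 'I_d | p.1 == ord0] (labels n' S)).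
apply/eqP; congr addn; last by apply: eq_card => p; rewrite !inE andbC.
rewrite -(card_imset _ (fun i j (e : (ord0 : 'I_n, i) = (ord0, j)) => congr1 snd e)).
apply: eq_card => -[a b]; rewrite !inE /=.
apply/imsetP/andP => [[i + [-> ->]]|[lab /eqP eq_a]]; first by rewrite inE => ->.
by exists b; rewrite ?inE -?eq_a.
Qed.

Definition box : {fset pt} := [fset map_tuple (@nat_of_ord n) t | t : d.-tuple 'I_n].

Lemma in_box (x : pt) : (forall i, tnth x i < n) -> x \in box.
Proof.
move=> lt_x; apply/imfsetP; exists [tuple inord (tnth x i) | i < d] => //.
by apply: eq_from_tnth => i; rewrite tnth_map tnth_mktuple inordK.
Qed.

Lemma lower_set_tnth_lt (S : {fset pt}) x i :
  lower_set S -> #|` S| = n -> x \in S -> tnth x i < n.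
Proof.
move=> lS cS xS; rewrite -cS.
have axis_inj : injective (axis_pt i).
  by move=> c c' /(congr1 (fun t => tnth t i)); rewrite !tnth_mktuple eqxx.
have sub : [fset y in map (axis_pt i) (iota 0 (tnth x i).+1)] `<=` S.
  apply/fsubsetP => y; rewrite in_fset => /mapP[c]; rewrite mem_iota ltnS => /andP[_ le_c] ->.
  exact: lower_set_axis_pt lS xS le_c.
have := fsubset_leq_card sub.
by rewrite card_fseq undup_id ?map_inj_uniq ?iota_uniq // size_map size_iota.
Qed.

Definition lower_setb (S : {fset pt}) : bool :=
  if excluded_middle_informative (lower_set S) then true else false.

Lemma lower_setbP S : reflect (lower_set S) (lower_setb S).
Proof. by rewrite /lower_setb; case: excluded_middle_informative; constructor. Qed.

Definition lower_sets : seq {fset pt} :=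
  [seq S <- enum_fset (fpowerset box) | lower_setb S && (#|` S| == n)].

Lemma mem_lower_sets S : S \in lower_sets <-> lower_set S /\ #|` S| = n.
Proof.
rewrite mem_filter fpowersetE; split => [/andP[/andP[/lower_setbP lS /eqP cS] _] //|[lS cS]].
rewrite cS eqxx andbT; apply/andP; split; first exact/lower_setbP.
by apply/fsubsetP => x xS; apply: in_box => i; apply: lower_set_tnth_lt lS cS xS.
Qed.

Lemma is_pd_lower_sets : is_pd d n (size lower_sets).
Proof.
by exists lower_sets; split; rewrite // ?filter_uniq ?fset_uniq //; apply: mem_lower_sets.
Qed.

Lemma size_lower_sets_le : size lower_sets <= #|codes|.
Proof.
have uniq_codes : uniq (map code lower_sets).
  rewrite map_inj_in_uniq ?filter_uniq ?fset_uniq // => S S' /mem_lower_sets[lS cS].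
  by case/mem_lower_sets => lS' cS'; apply: code_inj.
rewrite cardE -(size_map code); apply: uniq_leq_size => // _ /mapP[S /mem_lower_sets[lS cS] ->].
by rewrite mem_enum code_in_codes.
Qed.

End Codes.

Lemma ffact_le_expn m k : m ^_ k <= m ^ k.
Proof.
have -> : m ^ k = \prod_(i < k) m by rewrite prod_nat_const card_ord.
by rewrite ffact_prod; apply: leq_prod => i _; apply: leq_subr.
Qed.

Lemma sum_card_sets (T : finType) (F : nat -> nat) :
  \sum_(A : {set T}) F #|A| = \sum_(j < #|T|.+1) 'C(#|T|, j) * F j.
Proof.
rewrite (partition_big (fun A : {set T} => inord #|A| : 'I_#|T|.+1) xpredT) //=.
apply: eq_bigr => j _.
rewrite (eq_bigl (fun A : {set T} => #|A| == j)) => [|A]; last first.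
  by rewrite -val_eqE /= inordK // ltnS max_card.
rewrite (eq_bigr (fun _ => F j)) => [|A /eqP-> //].
by rewrite sum_nat_const -card_draws; congr (_ * _); apply: eq_card => A; rewrite inE.
Qed.

Lemma big_ord_widen_vanishing (F : nat -> nat) a b :
  a <= b -> (forall j, a <= j -> F j = 0) -> \sum_(j < b) F j = \sum_(j < a) F j.
Proof.
move=> le_ab F0; rewrite (big_ord_widen b F le_ab) [RHS]big_mkcond /=.
by apply: eq_bigr => j _; case: ltnP => // /F0 ->.
Qed.

Section CountCodes.
Variables d' n' : nat.
Local Notation d := d'.+1.
Local Notation n := n'.+1.

Lemma card_codes_fiber (J : {set 'I_d}) :
  #|[pred R | (J, R) \in codes d' n']| = 'C(n * #|J|, n' - #|J|) * (#|J| <= n').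
Proof.
have card_cells : #|setX [set: 'I_n] J| = n * #|J| by rewrite cardsX cardsT card_ord.
case: leqP => [le_J|lt_J]; rewrite /= ?muln1 ?muln0.
  rewrite -card_cells -cards_draws; apply: eq_card => R; rewrite !inE /=.
  by congr (_ && _); rewrite -[RHS](eqn_add2l #|J|) subnKC.
apply: eq_card0 => R; rewrite !inE /=; apply/negP => /andP[_ /eqP sum_n].
by move: lt_J; rewrite -sum_n ltnNge leq_addr.
Qed.

Lemma card_codes :
  #|codes d' n'| = \sum_(j < d.+1) 'C(d, j) * ('C(n * j, n' - j) * (j <= n')).
Proof.
rewrite -[in RHS](card_ord d).
rewrite -(sum_card_sets _ (fun j => 'C(n * j, n' - j) * (j <= n'))).
rewrite -(eq_bigr _ (fun J _ => card_codes_fiber J)) -[LHS]sum1_card.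
rewrite (eq_bigr (fun J => \sum_(R | (J, R) \in codes d' n') 1)) => [|J _]; last first.
  by rewrite sum1_card.
by rewrite pair_big_dep; apply: eq_bigl => -[J R].
Qed.

Lemma fact_card_codes_le : n'`! * #|codes d' n'| <= (n * n + d) ^ n'.
Proof.
pose t j := n'`! * ('C(d, j) * ('C(n * j, n' - j) * (j <= n'))).
have t_small j : n <= j -> t j = 0 by move=> lt_nj; rewrite /t leqNgt lt_nj /= !muln0.
have t_large j : d.+1 <= j -> t j = 0 by move=> lt_dj; rewrite /t bin_small // mul0n muln0.
rewrite card_codes big_distrr /= -/t.
rewrite -(big_ord_widen_vanishing (leq_addr n d.+1) t_large).
rewrite (big_ord_widen_vanishing (leq_addl d.+1 n) t_small) expnDn.
apply: leq_sum => -[j /=]; rewrite ltnS => le_jn _; rewrite /t le_jn muln1.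
have -> : n'`! * ('C(d, j) * 'C(n * j, n' - j)) = 'C(n', j) * ((n * j) ^_ (n' - j) * d ^_ j).
  by rewrite -(bin_fact le_jn) -!bin_ffact; lia.
rewrite leq_mul // leq_mul ?(leq_trans (ffact_le_expn _ _)) //.
by case: (n' - j) => // e; rewrite leq_exp2r // leq_mul2l ltnW.
Qed.
End CountCodes.

Section RealBounds.
Local Open Scope R_scope.

Lemma INR_muln a b : INR (a * b)%N = INR a * INR b.
Proof. exact: mult_INR. Qed.

Lemma INR_addn a b : INR (a + b)%N = INR a + INR b.
Proof. exact: plus_INR. Qed.

Lemma INR_expn a m : INR (a ^ m)%N = INR a ^ m.
Proof. by elim: m => [|m IH] //=; rewrite expnS INR_muln IH. Qed.

Lemma exp_mul_INR x m : exp (INR m * x) = exp x ^ m.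
Proof.
elim: m => [|m IH]; first by rewrite Rmult_0_l exp_0.
by rewrite S_INR Rmult_plus_distr_r Rmult_1_l exp_plus IH /= Rmult_comm.
Qed.

Lemma exp_le_compat x y : x <= y -> exp x <= exp y.
Proof. by case/Rle_lt_or_eq_dec => [/exp_increasing/Rlt_le|->]; [|apply: Rle_refl]. Qed.

Lemma pow_add_le_exp (b a : R) m :
  0 <= a -> 0 < b -> (b + a) ^ m <= b ^ m * exp (INR m * a / b).
Proof.
move=> a_ge0 b_gt0.
have -> : INR m * a / b = INR m * (a / b) by rewrite /Rdiv Rmult_assoc.
rewrite exp_mul_INR -Rpow_mult_distr; apply: pow_incr; split; first lra.
have -> : b + a = b * (1 + a / b) by field; lra.
by apply: Rmult_le_compat_l; [lra | apply: exp_ineq1_le].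
Qed.

Lemma pow_le_fact_exp n : INR n ^ n <= INR n`! * exp (INR n).
Proof.
elim: n => [|n IH]; first by rewrite /= exp_0; lra.
have step : INR n.+1 ^ n <= INR n ^ n * exp 1.
  case: n IH => [_|n _]; first by rewrite /= Rmult_1_l; have := exp_ineq1_le 1; lra.
  have N_gt0 : 0 < INR n.+1 by apply: lt_0_INR; apply/ltP.
  have := pow_add_le_exp n.+1 (Rle_0_1) N_gt0.
  by rewrite -S_INR Rmult_1_r /Rdiv Rinv_r //; lra.
rewrite factS INR_muln [in exp _]S_INR exp_plus -tech_pow_Rmult Rmult_assoc.
apply: Rmult_le_compat_l; first exact: pos_INR.
apply: Rle_trans step _; rewrite -Rmult_assoc; apply: Rmult_le_compat_r; first exact: Rlt_le (exp_pos 1).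
exact: IH.
Qed.

Lemma fact_mul_le_exp (d m k : nat) (xi : R) :
  (0 < d)%N -> 0 < xi -> xi * INR m.+1 ^ 2 <= INR d ->
  (m`! * k <= (m.+1 * m.+1 + d) ^ m)%N ->
  INR m`! * INR k <= INR d ^ m * exp (INR m.+1 / xi).
Proof.
move=> d_gt0 xi_gt0 le_d /leP/le_INR.
rewrite INR_muln INR_expn INR_addn INR_muln Rplus_comm.
set N := INR m.+1 in le_d *; set D := INR d in le_d * => le_k.
have D_gt0 : 0 < D by apply: lt_0_INR; apply/ltP.
have m_ge0 := pos_INR m.
have m_leN : INR m <= N by rewrite /N S_INR; lra.
have le_exponent : INR m * (N * N) / D <= N / xi.
  apply: (Rmult_le_reg_r (xi * D)); first nra.
  have -> : INR m * (N * N) / D * (xi * D) = INR m * (xi * N ^ 2) by field; lra.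
  have -> : N / xi * (xi * D) = N * D by field; lra.
  apply: (Rle_trans _ (INR m * D)); first by apply: Rmult_le_compat_l; lra.
  by apply: Rmult_le_compat_r; lra.
apply: Rle_trans le_k _; apply: Rle_trans (pow_add_le_exp m _ D_gt0) _; first nra.
apply: Rmult_le_compat_l; first by apply: pow_le; lra.
exact: exp_le_compat.
Qed.

Lemma mul_pow_self_le (d m k : nat) (xi : R) :
  (0 < d)%N -> 0 < xi -> xi * INR m.+1 ^ 2 <= INR d ->
  (m`! * k <= (m.+1 * m.+1 + d) ^ m)%N ->
  INR k * INR m.+1 ^ m.+1 <= INR d ^ m * exp (INR m.+1 / xi) * (INR m.+1 * exp (INR m.+1)).
Proof.
move=> d_gt0 xi_gt0 le_d le_k.
have le_fk := fact_mul_le_exp d_gt0 xi_gt0 le_d le_k.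
have := pow_le_fact_exp m.+1; rewrite factS INR_muln => le_N.
apply: (Rle_trans _ (INR k * (INR m.+1 * INR m`! * exp (INR m.+1)))).
  by apply: Rmult_le_compat_l; first exact: pos_INR.
have -> : INR k * (INR m.+1 * INR m`! * exp (INR m.+1))
  = INR m`! * INR k * (INR m.+1 * exp (INR m.+1)) by ring.
apply: Rmult_le_compat_r => //; apply: Rmult_le_pos; first exact: pos_INR.
exact/Rlt_le/exp_pos.
Qed.

Lemma pd_bound_of_fact_bound (d m k : nat) (xi : R) :
  (0 < d)%N -> 0 < xi -> xi * INR m.+1 ^ 2 <= INR d ->
  (m`! * k <= (m.+1 * m.+1 + d) ^ m)%N ->
  INR k < 3 * (Rmax (2 * exp (35 / 10) / xi) 1) ^ (2 * m.+1)
            * exp (125 * INR m.+1 / xi) * INR m.+1 ^ 2 * exp (INR m.+1)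
            * (INR d ^ m.+1 / INR m.+1 ^ m.+1).
Proof.
move=> d_gt0 xi_gt0 le_d le_k.
have le_kN := mul_pow_self_le d_gt0 xi_gt0 le_d le_k.
set N := INR m.+1 in le_kN *; set D := INR d in le_kN *.
set A := Rmax _ 1; set E := exp (125 * N / xi).
have N_ge1 : 1 <= N by rewrite /N S_INR; have := pos_INR m; lra.
have D_ge1 : 1 <= D by apply: (le_INR 1); apply/leP.
have A_ge1 : 1 <= A ^ (2 * m.+1) by apply/pow_R1_Rle/Rmax_r.
have Dm_gt0 : 0 < D ^ m by apply: pow_lt; lra.
have NN_gt0 : 0 < N ^ m.+1 by apply: pow_lt; lra.
have le_D : D ^ m * N <= A ^ (2 * m.+1) * (N ^ 2 * D ^ m.+1).
  have le_DN : D ^ m * N <= N ^ 2 * D ^ m.+1.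
    have -> : N ^ 2 * D ^ m.+1 = (N * D) * (D ^ m * N) by change (D ^ m.+1) with (D * D ^ m); ring.
    by rewrite -[X in X <= _]Rmult_1_l; apply: Rmult_le_compat_r; nra.
  by rewrite -[X in X <= _]Rmult_1_l; apply: Rmult_le_compat => //; nra.
have le_E : exp (N / xi) * exp N <= E * exp N.
  apply: Rmult_le_compat_r; first exact/Rlt_le/exp_pos.
  apply: exp_le_compat; apply: Rmult_le_compat_r; first exact/Rlt_le/Rinv_0_lt_compat.
  lra.
have DN_gt0 : 0 < D ^ m * N by apply: Rmult_lt_0_compat; lra.
have e_gt0 : 0 < exp (N / xi) * exp N by apply: Rmult_lt_0_compat; apply: exp_pos.
apply: (Rmult_lt_reg_r (N ^ m.+1)) => //; apply: Rle_lt_trans le_kN _.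
have -> : 3 * A ^ (2 * m.+1) * E * N ^ 2 * exp N * (D ^ m.+1 / N ^ m.+1) * N ^ m.+1
  = 3 * ((A ^ (2 * m.+1) * (N ^ 2 * D ^ m.+1)) * (E * exp N)) by field; lra.
have -> : D ^ m * exp (N / xi) * (N * exp N) = D ^ m * N * (exp (N / xi) * exp N) by ring.
have := Rmult_le_compat _ _ _ _ (Rlt_le _ _ DN_gt0) (Rlt_le _ _ e_gt0) le_D le_E.
have := Rmult_lt_0_compat _ _ DN_gt0 e_gt0; lra.
Qed.

End RealBounds.

Theorem proposition4 (d n : nat) (xi : R) :
  (0 < d)%nat -> (0 < n)%nat ->
  (xi >= 2 / INR n)%R ->
  (INR d >= xi * INR n ^ 2)%R ->
  exists k : nat, is_pd d n k /\
    (INR k < 3 * (Rmax (2 * exp (35 / 10) / xi) 1) ^ (2 * n)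
               * exp (125 * INR n / xi) * INR n ^ 2 * exp (INR n)
               * (INR d ^ n / INR n ^ n))%R.
Proof.
case: d => // d' _; case: n => // n' _ le_xi le_d.
have xi_gt0 : (0 < xi)%R.
  apply: Rlt_le_trans (Rge_le _ _ le_xi); apply: Rdiv_lt_0_compat; first lra.
  exact/lt_0_INR/ltP.
exists (size (lower_sets d' n')); split; first exact: is_pd_lower_sets.
apply: pd_bound_of_fact_bound => //; first exact: Rge_le.
apply: leq_trans (fact_card_codes_le d' n'); rewrite leq_mul2l.
by rewrite size_lower_sets_le orbT.
Qed.
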